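(* Let $G$ be a finite group with centre $Z$, $\bar G=G/Z$, and $\rho:G\to\mathrm{GL}(V)$ an irreducible representation of dimension $s$, unitary with respect to a positive-definite Hermitian form $\langle\cdot,\cdot\rangle$ on $V$. Suppose $\mathcal{Y}$ is an equiangular $G$-bouquet for $\rho$. Then $\rho$ is an SV-representation (i.e. $|\bar G|=s^2$), and $\mathfrak{a}(\ell,\ell')=1/\sqrt{s+1}$ for all $\ell\ne\ell'$ in $\mathcal{Y}$.
   Context: $\bar G$ acts on the set $\mathbb{P}V$ of complex lines of $V$ by $\bar g\cdot\mathbb{C}v=\mathbb{C}\rho(g)v$ (well defined since $Z$ acts by scalars). A $G$-bouquet is an orbit of this action; it is free if the stabiliser in $\bar G$ of one (equivalently every) line in it is trivial, i.e. $|\mathcal{Y}|=|\bar G|$. The angle between lines is $\mathfrak{a}(\ell,\ell')=|\langle v,v'\rangle|$ for unit vectors $v\in\ell,v'\in\ell'$. A free bouquet $\mathcal{Y}$ is equiangular if $\mathfrak{a}(\ell,\ell')$ is the same for all pairs $\ell\ne\ell'$ in $\mathcal{Y}$. An SV-representation is an irreducible representation with $|G/Z|=(\dim V)^2$. *)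

(* Defs.v *)
From HB Require Import structures.
From mathcomp Require Import all_boot all_order all_algebra all_fingroup.
From mathcomp Require Import all_solvable mxrepresentation.
From mathcomp Require Import reals complex.

Set Implicit Arguments.
Unset Strict Implicit.
Unset Printing Implicit Defensive.

Import Order.TTheory GRing.Theory Num.Theory.
Local Open Scope ring_scope.

(* Representations of G act on row vectors from the right, v |-> v *m rG g, as
   everywhere in MathComp.  A left representation rho on V becomes one of these
   through g |-> rho(g^-1), and this changes neither the orbits on lines nor
   their stabilisers.  A line of V = C^s is a {vspace 'rV[C]_s} of dimension 1. *)

Section Bouquets.

Variables (C : numClosedFieldType) (gT : finGroupType) (G : {group gT}).
Variables (s : nat) (rG : mx_representation C G s).
Variable form : {dot 'rV[C]_s for Num.conj}.

Local Notation line := {vspace 'rV[C]_s}.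
Local Notation Gbar := (G / 'Z(G))%g.

Definition unitary_rep : Prop :=
  forall g, g \in G -> isometry form form (mulmxr (rG g)).

Definition line_act (g : gT) (l : line) : line :=
  (linfun (mulmxr (rG g)) @: l)%VS.

(* The result does not depend on the representative: see bar_act_coset. *)
Definition bar_act (x : coset_of 'Z(G)) (l : line) : line :=
  line_act (repr x) l.

Definition bar_stab (l : line) : {set coset_of 'Z(G)} :=
  [set x in Gbar | bar_act x l == l].

Definition bouquet (Y : {pred line}) : Prop :=
  exists2 l : line, \dim l = 1%N & Y =i [seq bar_act x l | x in Gbar].

Definition free_bouquet (Y : {pred line}) : Prop :=
  bouquet Y /\ exists2 l : line, l \in Y & bar_stab l = 1%g.

Definition unit_vector (l : line) : 'rV[C]_s :=
  (sqrtC (form (vpick l) (vpick l)))^-1 *: vpick l.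

(* The choice of the unit vectors is immaterial: see angleE. *)
Definition angle (l l' : line) : C :=
  `|form (unit_vector l) (unit_vector l')|.

Definition equiangular_bouquet (Y : {pred line}) : Prop :=
  free_bouquet Y /\
  forall l1 l1' l2 l2' : line,
    l1 \in Y -> l1' \in Y -> l1 != l1' ->
    l2 \in Y -> l2' \in Y -> l2 != l2' ->
    angle l1 l1' = angle l2 l2'.

Definition SV_representation : Prop :=
  mx_irreducible rG /\ #|Gbar| = (s ^ 2)%N.

Lemma center_scalar z : mx_irreducible rG -> z \in 'Z(G)%g ->
  exists2 a : C, a != 0 & rG z = a%:M.
Proof.
move=> irrG Zz; have [Gz cGz] := setIP Zz.
have absG := @group_closure_closed_field C gT G s rG irrG.
have cz : centgmx rG (rG z).
  apply/centgmxP => x Gx.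
  by rewrite -!repr_mxM // (centP cGz x Gx).
have /is_scalar_mxP[a def_z] := mx_abs_irr_cent_scalar absG cz.
exists a => //; apply/eqP => a0.
have := repr_mx_unit rG Gz; rewrite def_z a0 unitmxE det_scalar.
by have [s_gt0 _] := (mx_irrP _).1 irrG; rewrite expr0n gtn_eqF // unitr0.
Qed.

Lemma bar_act_coset g l : mx_irreducible rG -> g \in G ->
  bar_act (coset 'Z(G) g) l = line_act g l.
Proof.
move=> irrG Gg; rewrite /bar_act.
have Ng : g \in 'N('Z(G))%g by apply: (subsetP (normal_norm (center_normal G))).
rewrite val_coset //; have [z Zz ->] := rcosetP (mem_repr_rcoset 'Z(G) g).
have [a a0 def_z] := center_scalar irrG Zz.
have Gz : z \in G by have /setIP[] := Zz.
rewrite /line_act.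
have actE v : linfun (mulmxr (rG (z * g)%g)) v =
              a *: linfun (mulmxr (rG g)) v.
  rewrite !lfunE /= repr_mxM // def_z.
  by rewrite mulmxA mul_mx_scalar -scalemxAl.
apply/vspaceP => w; apply/memv_imgP/memv_imgP => -[v lv ->].
  by exists (a *: v); rewrite ?memvZ // actE linearZ.
exists (a^-1 *: v); first by rewrite memvZ.
by rewrite actE linearZ scalerA mulfV // scale1r.
Qed.

Lemma unit_vectorP l v : \dim l = 1%N -> v \in l -> form v v = 1 ->
  exists2 a : C, `|a| = 1 & v = a *: unit_vector l.
Proof.
move=> dl lv v1.
have p0 : vpick l != 0 by rewrite vpick0 -dimv_eq0 dl.
have lE : l = <[vpick l]>%VS.
  apply/esym/eqP; rewrite eqEdim -memvE memv_pick dl dim_vline.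
  by rewrite p0.
move: lv; rewrite {1}lE => /vlineP[k def_v].
have n0 : sqrtC (form (vpick l) (vpick l)) != 0 by rewrite sqrt_dnorm_eq0.
have def_v' : v = (k * sqrtC (form (vpick l) (vpick l))) *: unit_vector l.
  by rewrite /unit_vector scalerA mulfK.
exists (k * sqrtC (form (vpick l) (vpick l))) => //.
move: v1; rewrite def_v dnormZ -[form _ _ in X in X = _]sqrtCK.
rewrite -[sqrtC _ in X in X = _]ger0_norm ?sqrt_dnorm_ge0 //.
rewrite -exprMn -normrM => /eqP; rewrite sqrp_eq1 ?normr_ge0 //.
by move/eqP.
Qed.

Lemma angleE l l' v v' : \dim l = 1%N -> \dim l' = 1%N ->
  v \in l -> v' \in l' -> form v v = 1 -> form v' v' = 1 ->
  angle l l' = `|form v v'|.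
Proof.
move=> dl dl' lv lv' v1 v'1.
have [a a1 ->] := unit_vectorP dl lv v1.
have [b b1 ->] := unit_vectorP dl' lv' v'1.
by rewrite linearZl_LR linearZr_LR /= !normrM norm_conjC a1 b1 !mul1r.
Qed.

End Bouquets.

(* Main.v *)
(** Let [P_l] be the orthogonal projection onto a line [l], and [a] the common
    value of the squared angle, so that [tr (P_l P_l') = a] for [l != l'].  As
    [a < 1] by Cauchy-Schwarz, the [P_l] are linearly independent in the algebra
    of [s] by [s] matrices, whence [n := |Gbar| <= s^2]; the reverse inequality
    holds because representatives of [Gbar] span that algebra.  By Schur's lemma
    the [P_l] add up to [n / s] times the identity; taking the trace against one
    of them gives [1 + (n - 1) a = n / s], that is [a = 1 / (s + 1)]. *)

Require Import Defs.
From mathcomp Require Import all_boot all_order all_algebra all_fingroup.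
From mathcomp Require Import all_solvable mxrepresentation.
From mathcomp Require Import reals complex.
Set Implicit Arguments.
Unset Strict Implicit.
Unset Printing Implicit Defensive.

Import GRing.Theory Num.Theory.
Local Open Scope ring_scope.

(** * Rank-one projections in the trace form *)

Section LineProjections.

Variables (C : numClosedFieldType) (s : nat) (form : {dot 'rV[C]_s for Num.conj}).
Implicit Types u v w : 'rV[C]_s.

(** The matrix of the functional [form _ v]; as [form] is any Hermitian form, this replaces the
    conjugate transpose of [v]. *)
Definition dual_col v : 'cV[C]_s := \col_i form (delta_mx 0 i) v.

(** Acting on rows from the right it sends [u] to [form u v *: v], which for a unit vector [v] is
    the orthogonal projection onto its line. *)
Definition line_proj v : 'M[C]_s := dual_col v *m v.

Lemma mul_dual_col u v : u *m dual_col v = (form u v)%:M.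
Proof.
apply/rowP => j; rewrite !mxE ord1 mulr1n [u in RHS]row_sum_delta linear_sumlz /=.
by apply: eq_bigr => i _; rewrite !mxE linearZl_LR.
Qed.

Lemma mxtrace_line_proj v : \tr (line_proj v) = form v v.
Proof. by rewrite mxtrace_mulC mul_dual_col mxtrace_scalar mulr1n. Qed.

Lemma mxtrace_line_projM v w :
  \tr (line_proj v *m line_proj w) = `|form v w| ^+ 2.
Proof.
rewrite /line_proj mulmxA -[_ *m v *m _]mulmxA mul_dual_col mul_mx_scalar.
rewrite -scalemxAl mxtraceZ mxtrace_mulC mul_dual_col mxtrace_scalar mulr1n.
by rewrite normCK [form w v]hermC expr0 mul1r.
Qed.

(* Pairing a linear relation between the projections with one of them under the
   trace form kills its coefficients: their Gram matrix is (1 - a) I + a J. *)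
Lemma equiangular_leq_sqr n (w : 'I_n -> 'rV[C]_s) (a : C) :
    a != 1 -> (forall i, form (w i) (w i) = 1) ->
    (forall i j, i != j -> `|form (w i) (w j)| ^+ 2 = a) ->
  (n <= s ^ 2)%N.
Proof.
move=> a_neq1 w1 wa.
pose P := \matrix_(i < n) mxvec (line_proj (w i)).
suff /eqP <- : row_free P by rewrite (leq_trans (rank_leq_col P)) // expnS expn1.
rewrite -kermx_eq0; apply/rowV0P => c /sub_kermxP cP0.
have cP : \sum_i c 0 i *: line_proj (w i) = 0.
  apply: (can_inj mxvecK); rewrite !linear0 -[RHS]cP0 mulmx_sum_row linear_sum.
  by apply: eq_bigr => i _; rewrite linearZ rowK.
(* Each projection has trace 1, so the trace of the relation disposes of the J part of the Gram
   matrix. *)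
have sum_c : \sum_i c 0 i = 0.
  have := congr1 mxtrace cP; rewrite mxtrace0 raddf_sum /=; apply: etrans.
  by apply: eq_bigr => i _; rewrite mxtraceZ mxtrace_line_proj w1 mulr1.
apply/rowP => j; rewrite mxE.
have := congr1 (fun A => \tr (A *m line_proj (w j))) cP.
rewrite /= mul0mx mxtrace0 mulmx_suml raddf_sum /= (bigD1 j) //=.
rewrite -scalemxAl mxtraceZ mxtrace_line_projM w1 normr1 expr1n mulr1.
rewrite (eq_bigr (fun i => c 0 i * a)); last first.
  by move=> i ne_ij; rewrite -scalemxAl mxtraceZ mxtrace_line_projM wa.
rewrite -mulr_suml; move: sum_c; rewrite (bigD1 j) //= => /eqP.
rewrite addrC addr_eq0 => /eqP ->; rewrite mulNr -{1}[c 0 j]mulr1 -mulrBr.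
by move/eqP; rewrite mulf_eq0 subr_eq0 [1 == a]eq_sym (negPf a_neq1) orbF => /eqP.
Qed.

End LineProjections.

(** * The action of the central quotient on lines and projections *)

Section FreeOrbit.

Variables (C : numClosedFieldType) (gT : finGroupType) (G : {group gT}).
Variables (s : nat) (rG : mx_representation C G s).
Variable form : {dot 'rV[C]_s for Num.conj}.
Hypothesis irrG : mx_irreducible rG.

Local Notation Gbar := (G / 'Z(G))%g.

Lemma repr_quotient_mem x : x \in Gbar -> repr x \in G.
Proof.
case/morphimP => g Ng Gg ->; rewrite val_coset //.
have [z /setIP[Gz _] ->] := rcosetP (mem_repr_rcoset 'Z(G) g).
exact: groupM.
Qed.

(* Burnside's theorem: representatives of the cosets of the centre already span
   the full matrix algebra, as the centre acts by scalars. *)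
Lemma irr_sqr_leq_quotient : (s ^ 2 <= #|Gbar|)%N.
Proof.
have /andP[_ /eqP full] := @group_closure_closed_field C gT G s rG irrG.
rewrite expnS expn1 -{}full.
pose B := \matrix_(i < #|Gbar|) mxvec (rG (repr (enum_val i))).
apply: leq_trans (rank_leq_row B); apply: mxrankS.
apply/row_subP => i; rewrite rowK; have Gg := enum_valP i.
move: (enum_val i) Gg => g Gg {i}.
have Ng : g \in 'N('Z(G))%g by apply: (subsetP (normal_norm (center_normal G))).
have Gx : coset 'Z(G) g \in Gbar by apply: mem_quotient.
have [z Zz def_r] := rcosetP (mem_repr_rcoset 'Z(G) g).
have [a a0 def_z] := center_scalar irrG Zz; have /setIP[Gz _] := Zz.
have -> : rG g = a^-1 *: rG (repr (coset 'Z(G)%g g)).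
  rewrite val_coset // def_r repr_mxM // def_z mul_scalar_mx scalerA mulVf //.
  by rewrite scale1r.
rewrite linearZ scalemx_sub //.
rewrite (eq_row_sub (enum_rank_in Gx (coset 'Z(G)%g g))) //.
by rewrite rowK enum_rankK_in.
Qed.

Lemma bar_actM x y l : x \in Gbar -> y \in Gbar ->
  bar_act rG (x * y)%g l = bar_act rG y (bar_act rG x l).
Proof.
case/morphimP=> g Ng Gg -> /morphimP[h Nh Gh ->]; rewrite /= -morphM //.
rewrite !bar_act_coset ?groupM // /line_act -limg_comp; congr (_ @: _)%VS.
by apply/lfunP => v; rewrite comp_lfunE !lfunE /= repr_mxM // mulmxA.
Qed.

Lemma bar_act1 l : bar_act rG 1%g l = l.
Proof.
rewrite -(morph1 (coset_morphism 'Z(G)%g)) /= bar_act_coset // /line_act.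
rewrite -[RHS]lim1g; congr (_ @: _)%VS.
by apply/lfunP => v; rewrite !lfunE /= repr_mx1 mulmx1.
Qed.

Lemma bar_act_line x v : bar_act rG x <[v]>%VS = <[v *m rG (repr x)]>%VS.
Proof. by rewrite /bar_act /line_act limg_line lfunE. Qed.

Lemma bar_act_free_inj l x y : bar_stab rG l = 1%g ->
  x \in Gbar -> y \in Gbar -> bar_act rG x l = bar_act rG y l -> x = y.
Proof.
move=> free_l Gx Gy eq_xy; apply/eqP; rewrite eq_mulgV1; apply/eqP/set1gP.
rewrite -free_l inE groupM ?groupV //= bar_actM ?groupV // eq_xy.
by rewrite -bar_actM ?groupV // mulgV bar_act1.
Qed.

(** Moves the base point of the orbit to the line at which the stabiliser is known to be trivial. *)
Lemma bouquetE (Y : {pred {vspace 'rV[C]_s}}) l : bouquet rG Y -> l \in Y ->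
  Y =i [seq bar_act rG x l | x in Gbar].
Proof.
case=> l0 _ defY; rewrite defY => /imageP[h Gh ->] m; rewrite defY.
apply/imageP/imageP => -[x Gx ->].
  exists (h^-1 * x)%g; first by rewrite groupM ?groupV.
  by rewrite -bar_actM ?groupM ?groupV // mulKVg.
by exists (h * x)%g; rewrite ?groupM // bar_actM.
Qed.

Lemma dim_bouquet (Y : {pred {vspace 'rV[C]_s}}) l :
  bouquet rG Y -> l \in Y -> \dim l = 1%N.
Proof.
case=> l0 dim_l0 defY; rewrite defY => /imageP[x Gx ->].
rewrite /bar_act /line_act limg_dim_eq ?dim_l0 //.
apply/eqP; rewrite -subv0; apply/subvP => v; rewrite memv_cap memv_ker lfunE /=.
case/andP=> _ /eqP v0.
by rewrite memv0 -[v](repr_mxK rG (repr_quotient_mem Gx)) v0 mul0mx.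
Qed.

Hypothesis unitaryG : unitary_rep rG form.

(** Unitarity moves [g] across the form, so the dual column of [v *m rG g] is [rG g^-1] times that
    of [v]; this is checked row by row on the standard basis. *)
Lemma line_proj_act v g : g \in G ->
  line_proj form (v *m rG g) = rG g^-1%g *m line_proj form v *m rG g.
Proof.
move=> Gg; rewrite /line_proj !mulmxA; congr (_ *m _ *m _).
apply/row_matrixP => i; rewrite row_mul !rowE !mul_dual_col; congr _%:M.
by rewrite -[in RHS](unitaryG Gg) /= (repr_mxKV rG Gg).
Qed.

(** Two representatives differ by a central element, which acts by a scalar, and conjugation by a
    scalar matrix is trivial. *)
Lemma line_proj_repr v g : g \in G ->
  line_proj form (v *m rG (repr (coset 'Z(G)%g g))) =
  line_proj form (v *m rG g).
Proof.
move=> Gg.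
have Ng : g \in 'N('Z(G))%g by apply: (subsetP (normal_norm (center_normal G))).
rewrite val_coset //; have [z Zz ->] := rcosetP (mem_repr_rcoset 'Z(G) g).
have [a _ def_z] := center_scalar irrG Zz; have /setIP[Gz _] := Zz.
rewrite repr_mxM // mulmxA line_proj_act // [in RHS]line_proj_act //.
congr (_ *m _ *m _); rewrite line_proj_act // -mulmxA def_z scalar_mxC.
by rewrite -def_z mulmxA -repr_mxM ?groupV // mulVg repr_mx1 mul1mx.
Qed.

Lemma line_proj_mul_coset v x h : x \in Gbar -> h \in G ->
  line_proj form (v *m rG (repr (x * coset 'Z(G) h)%g)) =
  rG h^-1%g *m line_proj form (v *m rG (repr x)) *m rG h.
Proof.
move=> Gx Gh; have Gr := repr_quotient_mem Gx.
have nZ := subsetP (normal_norm (center_normal G)).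
have -> : (x * coset 'Z(G) h = coset 'Z(G) (repr x * h))%g.
  by rewrite morphM ?nZ //= coset_reprK.
by rewrite line_proj_repr ?groupM // repr_mxM // mulmxA line_proj_act.
Qed.

Lemma sum_line_proj v : form v v = 1 ->
  \sum_(x in Gbar) line_proj form (v *m rG (repr x)) =
  (#|Gbar|%:R / s%:R)%:M.
Proof.
move=> v1; set S := \sum_(x in _) _.
have absG := @group_closure_closed_field C gT G s rG irrG.
have s_gt0 : (0 < s)%N by case/andP: absG.
have cS : centgmx rG S.
  apply/centgmxP => h Gh.
  have Ghb : coset 'Z(G) h \in Gbar by apply: mem_quotient.
  (* Conjugation by [h] only permutes the summands, by right translation on [Gbar]; Schur's lemma
     then makes [S] scalar, and its trace fixes the scalar. *)
  suff defS : S = rG h^-1%g *m S *m rG h.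
    by rewrite {2}defS !mulmxA -repr_mxM ?groupV // mulgV repr_mx1 mul1mx.
  rewrite mulmx_sumr mulmx_suml {1}/S.
  rewrite (reindex_inj (mulIg (coset 'Z(G) h))) /=.
  apply: eq_big => [x|x Gxh]; first by rewrite groupMr.
  have Gx : x \in Gbar by rewrite groupMr in Gxh.
  exact: line_proj_mul_coset.
have /is_scalar_mxP[b defS] := mx_abs_irr_cent_scalar absG cS.
have : \tr S = #|Gbar|%:R.
  rewrite raddf_sum /= (eq_bigr (fun _ => 1)) ?sumr_const // => x Gx.
  by rewrite mxtrace_line_proj -v1 (unitaryG (repr_quotient_mem Gx)).
rewrite defS mxtrace_scalar -[b *+ s]mulr_natr => <-.
by rewrite mulfK // pnatr_eq0 -lt0n.
Qed.

(** The value of [a] is claimed only for [1 < s]: when [s] is 1 the orbit is a single line and no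
    pair constrains [a]. *)
Lemma equiangular_orbit v (a : C) :
    form v v = 1 -> a != 1 ->
    {in Gbar &, forall x y : coset_of 'Z(G), x != y ->
      `|form (v *m rG (repr x)) (v *m rG (repr y))| ^+ 2 = a} ->
  #|Gbar| = (s ^ 2)%N /\ ((1 < s)%N -> a = (s.+1)%:R^-1).
Proof.
move=> v1 a_neq1 va.
have w1 x : x \in Gbar -> form (v *m rG (repr x)) (v *m rG (repr x)) = 1.
  by move=> Gx; rewrite -v1 (unitaryG (repr_quotient_mem Gx)).
have card_Gbar : #|Gbar| = (s ^ 2)%N.
  apply/eqP; rewrite eqn_leq irr_sqr_leq_quotient andbT.
  apply: (@equiangular_leq_sqr C s form #|Gbar|
            (fun i => v *m rG (repr (enum_val i))) a) => // [i|i j ne_ij].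
    exact: w1 (enum_valP i).
  by apply: va; rewrite ?enum_valP ?(inj_eq enum_val_inj).
split=> // s_gt1; set w := v *m rG (repr (1%g : coset_of 'Z(G))).
(* With [#|Gbar|] equal to s^2 this reads 1 + (s^2 - 1) a = s; factoring s^2 - 1 and cancelling s -
   1 leaves (s + 1) a = 1. *)
have := congr1 (fun A => \tr (line_proj form w *m A)) (sum_line_proj v1).
rewrite /= mulmx_sumr raddf_sum /= (bigD1 1%g) ?group1 //=.
rewrite mxtrace_line_projM w1 ?group1 // normr1 expr1n.
rewrite (eq_bigr (fun _ => a)); last first.
  by move=> x /andP[Gx x1]; rewrite mxtrace_line_projM va // eq_sym.
rewrite mul_mx_scalar mxtraceZ mxtrace_line_proj w1 ?group1 // mulr1 sumr_const.
have -> : #|[pred x in Gbar | x != 1%g]| = (s ^ 2).-1.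
  have := cardD1 1%g Gbar; rewrite group1 card_Gbar => ->.
  by apply: eq_card => x; rewrite !inE andbC.
have s_neq0 : s%:R != 0 :> C by rewrite pnatr_eq0 -lt0n ltnW.
have s_neq1 : s%:R - 1 != 0 :> C.
  by rewrite subr_eq0 pnatr_eq1 gtn_eqF.
have s1_neq0 : s.+1%:R != 0 :> C by rewrite pnatr_eq0.
rewrite -[a *+ _]mulr_natr.
have -> : (s ^ 2).-1%:R = (s%:R - 1) * s.+1%:R :> C.
  rewrite -subn1 natrB ?expn_gt0 ?(ltnW s_gt1) // natrX.
  by rewrite -[s.+1%:R]natr1 -subr_sqr expr1n.
rewrite card_Gbar natrX expr2 mulfK // => /eqP.
rewrite eq_sym addrC -subr_eq => /eqP eq_a.
apply: (mulIf s1_neq0); apply: (mulIf s_neq1).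
by rewrite mulVf // mul1r [RHS]eq_a mulrAC mulrA.
Qed.

Lemma equiangular_bouquet_SV (Y : {pred {vspace 'rV[C]_s}}) :
  equiangular_bouquet rG form Y ->
  SV_representation rG /\
  forall l l' : {vspace 'rV[C]_s}, l \in Y -> l' \in Y -> l != l' ->
    angle form l l' = 1 / sqrtC (s.+1)%:R.
Proof.
case=> [[bqY [l Yl free_l]] eq_angle].
have dimY := dim_bouquet bqY; have defY := bouquetE bqY Yl.
have nz_l : vpick l != 0 by rewrite vpick0 -dimv_eq0 (dimY l Yl).
pose v := unit_vector form l.
have v1 : form v v = 1.
  rewrite /v /unit_vector dnormZ normfV exprVn ger0_norm ?sqrt_dnorm_ge0 //.
  by rewrite sqrtCK mulVf // dnorm_eq0.
have lv : v \in l by rewrite memvZ // memv_pick.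
have nz_v : v != 0 by rewrite -(dnorm_eq0 form) v1 oner_eq0.
have def_l : l = <[v]>%VS.
  by apply/esym/eqP; rewrite eqEdim -memvE lv dimY // dim_vline nz_v.
pose w x := v *m rG (repr (x : coset_of 'Z(G))).
have Yw x : x \in Gbar -> <[w x]>%VS \in Y.
  by move=> Gx; rewrite defY -bar_act_line -def_l; apply/imageP; exists x.
have w1 x : x \in Gbar -> form (w x) (w x) = 1.
  by move=> Gx; rewrite -v1 (unitaryG (repr_quotient_mem Gx)).
have angle_w x y : x \in Gbar -> y \in Gbar ->
    angle form <[w x]> <[w y]> = `|form (w x) (w y)|.
  by move=> Gx Gy; rewrite (angleE _ _ (memv_line _) (memv_line _)) ?w1 ?dimY ?Yw.
have neq_w x y : x \in Gbar -> y \in Gbar -> x != y ->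
    <[w x]>%VS != <[w y]>%VS.
  move=> Gx Gy; apply: contra_neq; rewrite -!bar_act_line -def_l.
  exact: bar_act_free_inj.
have [a a_neq1 wa] : exists2 a : C, a != 1 &
    {in Gbar &, forall x y : coset_of 'Z(G), x != y ->
      `|form (w x) (w y)| ^+ 2 = a}.
  have [triv|/trivgPn[x Gx x1]] := eqVneq Gbar 1%g.
    (* There are no pairs to compare, so any value other than 1 would do. *)
    exists 0; first by rewrite eq_sym oner_eq0.
    by move=> x y; rewrite triv => /set1gP-> /set1gP->; rewrite eqxx.
  exists (`|form (w x) (w 1%g)| ^+ 2).
    (* Equality in Cauchy-Schwarz would make the two vectors span the same line, against freeness of
       the orbit. *)
    have [_] := CauchySchwarz form (w x) (w 1%g).
    rewrite !w1 ?group1 // mulr1 => ->; rewrite negbK.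
    have nz_w1 : w 1%g != 0 by rewrite -(dnorm_eq0 form) w1 ?group1 ?oner_eq0.
    rewrite free_cons span_seq1 seq1_free nz_w1 andbT.
    apply: contra (neq_w _ _ Gx (group1 _) x1) => wx.
    by rewrite eqEdim -memvE wx !dimY ?Yw ?group1.
  move=> y z Gy Gz yz; rewrite -(angle_w y z) // -(angle_w x 1%g) ?group1 //.
  congr (_ ^+ 2).
  by apply: eq_angle; rewrite ?Yw ?neq_w ?group1.
have [card_Gbar a_val] := equiangular_orbit v1 a_neq1 wa.
split=> // m m'; rewrite !defY => /imageP[x Gx ->] /imageP[y Gy ->].
rewrite def_l !bar_act_line => ne_xy.
have {}ne_xy : x != y by apply: contraNneq ne_xy => ->.
(* Two distinct lines give two elements of [Gbar], whose order is s^2. *)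
have s_gt1 : (1 < s)%N.
  rewrite -(ltn_exp2r 1 s (isT : (0 < 2)%N)) exp1n -card_Gbar.
  by rewrite (cardD1 x) Gx (cardD1 y) !inE eq_sym ne_xy Gy.
rewrite angle_w // div1r -(sqrCK (normr_ge0 _)) wa // a_val //.
by rewrite rootCV // ler0n.
Qed.

End FreeOrbit.

Theorem theorem3p6 (R : realType) (gT : finGroupType) (G : {group gT})
    (s : nat) (rG : mx_representation R[i] G s)
    (form : {dot 'rV[R[i]]_s for Num.conj})
    (irrG : mx_irreducible rG) (unitaryG : unitary_rep rG form)
    (Y : {pred {vspace 'rV[R[i]]_s}})
    (eqY : equiangular_bouquet rG form Y) :
  SV_representation rG /\
  forall l l' : {vspace 'rV[R[i]]_s}, l \in Y -> l' \in Y -> l != l' ->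
    angle form l l' = 1 / sqrtC (s.+1)%:R.
Proof.
exact: equiangular_bouquet_SV.
Qed.
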